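(* Let $n,T\ge1$ and let $z_1,\ldots,z_{n+1}$ be positive reals with $z_1+\cdots+z_{n+1}=1$. Consider the multispecies annihilation juggling Markov chain on $St_n^T$ described in the context. Its stationary distribution is given, for $w=w_1\cdots w_n\in St_n^T$, by $$\pi(w)=\Bigl(\prod_{\substack{1\le i\le n\\ w_i<T}} y_{E_w(i)}\Bigr)\Bigl(\prod_{\ell=2}^T\ \prod_{p=1}^{\#\{m:\ w_m\ge \ell\}}(1-y_p)\Bigr),\qquad E_w(i)=1+\#\{j:\ i\le j\le n,\ w_j>w_i\},$$ and no normalization is needed: $\sum_{w\in St_n^T}\pi(w)=(z_1+\cdots+z_{n+1})^{n(T-1)}=1$.
   Context: $St_n^T$ is the set of all words of length $n$ over $\{1,\ldots,T\}$. Let $y_i=z_1+\cdots+z_i$. For a word $u$ of length $n$ set $u_{n+1}=\infty$ and $J_u(m,t)=1+\#\{\ell:\ m\le\ell\le n,\ u_\ell>t\}$ for $m\in\{1,\ldots,n+1\}$. A bumping sequence for $u$ is an increasing integer sequence $a(1)<\cdots<a(k)$ with $a(1)=1$, $a(k)=n+1$, $u_{a(j)}<u_{a(j+1)}$ for $1\le j\le k-1$; $u^a$ is the word with $u^a_i=u_{a(\ell-1)}$ if $i=a(\ell)-1$ for some $\ell\in\{2,\ldots,k\}$ and $u^a_i=u_{i+1}$ otherwise. For $w\in St_n^T$, $j\in\{1,\ldots,T\}$, $u=jw_2\cdots w_n$ and $a$ a bumping sequence of $u$, define $$q_w(j,a)=z_{J_u(a(2),j)}\prod_{t=1}^{j-1}\bigl(1-y_{J_u(2,t)}\bigr)\prod_{i=3}^k\frac{z_{J_u(a(i),u_{a(i-1)})}}{y_{J_u(a(i-1),u_{a(i-1)})}}\quad\text{if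 } j<T,$$ and, for $j=T$ (in which case necessarily $a=(1,n+1)$), $q_w(T,a)=\prod_{t=1}^{T-1}(1-y_{J_u(2,t)})$. The transition probability from $w$ to $w'$ is the sum of $q_w(j,a)$ over all pairs $(j,a)$ with $(jw_2\cdots w_n)^a=w'$ (there is at most one such pair). (Interpretation: the juggler tries types $1,2,\ldots$ in turn; type $t$ is placed at the $\ell$-th available position from the right with probability $z_\ell$, failing if $\ell$ exceeds the number of available positions; if all types $<T$ fail, a $T$ goes to the rightmost position; displaced balls then bump as in the multispecies juggling chain.) *)

(* Defs.v *)
From HB Require Import structures.
From mathcomp Require Import all_boot all_order all_algebra.

Set Implicit Arguments.
Unset Strict Implicit.
Unset Printing Implicit Defensive.

Import Order.TTheory GRing.Theory Num.Theory.
Local Open Scope ring_scope.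

(* St_n^T: the ordinal c : 'I_T stands for the letter c + 1 in {1, ..., T}. *)
Definition word (n T : nat) := n.-tuple 'I_T.

Definition letters (n T : nat) (w : word n T) : seq nat :=
  [seq (val c).+1 | c <- w].

(* The letter u_m, 1-based. Past the end of u this is T + 1, which is larger
   than every letter and plays the role of u_{n+1} = oo. *)
Definition lett (T : nat) (u : seq nat) (m : nat) : nat := nth T.+1 u m.-1.

Definition J (T : nat) (u : seq nat) (m t : nat) : nat :=
  (1 + count (fun l => t < lett T u l) (index_iota m (size u).+1))%N.

(* The entry a(l), 1-based. *)
Definition entry (a : seq nat) (l : nat) : nat := nth 0%N a l.-1.

Definition is_bumping (T : nat) (u a : seq nat) : bool :=
  [&& sorted ltn a, entry a 1 == 1%N, entry a (size a) == (size u).+1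
    & sorted (fun p q => lett T u p < lett T u q)%N a].

(* u^a. If i + 1 = a(l) for some l >= 2, then index i.+1 a = l - 1 (index is
   0-based and a has no repetition), so the letter chosen is u_{a(l-1)}. *)
Definition bump (T : nat) (u a : seq nat) : seq nat :=
  [seq (if i.+1 \in behead a then lett T u (entry a (index i.+1 a))
        else lett T u i.+1) | i <- iota 1 (size u)].

Section Chain.
Variables (R : realFieldType) (n T : nat) (z : nat -> R).

Definition y (i : nat) : R := \sum_(1 <= l < i.+1) z l.

(* The word j w_2 ... w_n. *)
Definition replace_first (j : nat) (w : word n T) : seq nat :=
  j :: behead (letters w).

Definition q (w : word n T) (j : nat) (a : seq nat) : R :=
  let u := replace_first j w in
  if (j < T)%N then
    z (J T u (entry a 2) j)
    * (\prod_(1 <= t < j) (1 - y (J T u 2 t)))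
    * (\prod_(3 <= i < (size a).+1)
         (z (J T u (entry a i) (lett T u (entry a i.-1)))
          / y (J T u (entry a i.-1) (lett T u (entry a i.-1)))))
  else \prod_(1 <= t < T) (1 - y (J T u 2 t)).

(* A bumping sequence of a word of length n has at most n + 1 entries, all at
   most n + 1, so the bounded sequences below cover all of them. *)
Definition transition (w w' : word n T) : R :=
  \sum_(1 <= j < T.+1)
    \sum_(a : {bseq n.+1 of 'I_n.+2}
            | is_bumping T (replace_first j w) (map val a)
              && (bump T (replace_first j w) (map val a) == letters w'))
      q w j (map val a).

Definition E (w : word n T) (i : nat) : nat :=
  J T (letters w) i (lett T (letters w) i).

Definition stat_weight (w : word n T) : R :=
  (\prod_(1 <= i < n.+1 | (lett T (letters w) i < T)%N) y (E w i))
  * (\prod_(2 <= l < T.+1)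
       \prod_(1 <= p < (count (fun c => l <= c)%N (letters w)).+1) (1 - y p)).

End Chain.

Definition is_stationary_distribution (R : realFieldType) (S : finType)
    (P : S -> S -> R) (mu : S -> R) : Prop :=
  [/\ forall s, 0 <= mu s,
      \sum_s mu s = 1
    & forall s', \sum_s mu s * P s s' = mu s'].

(* Main.v *)
(** The weight satisfies pi(c v) = h(v, c) pi(v), where h(v, .) is the law of the
    first type that the juggler succeeds in placing when the rest of the word is
    v. Hence the sum of pi(c v) over c is pi(v), which gives the normalization,
    and the balance equation at w' becomes a sum over pairs (u, a) with u^a = w'
    of pi(u) times a product of ratios z/y. The factors 1 - y_p depend only on
    the multiset of letters, and the denominators cancel against factors of
    pi(u); what remains is summed by building w' letter by letter, using
    z_r + y_{r-1} = y_r. Uniqueness holds because the bumping sequence (1, n+1)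
    appends an arbitrary letter with positive probability, so that the chain is
    irreducible. *)

Require Import Defs.
From mathcomp Require Import all_boot all_order all_algebra.
From mathcomp Require Import zify ring.

Set Implicit Arguments.
Unset Strict Implicit.
Unset Printing Implicit Defensive.

Import Order.TTheory GRing.Theory Num.Theory.
Local Open Scope ring_scope.

(** * Encoding of bumping sequences by bit sequences *)

Definition rank (s : seq nat) (t : nat) : nat := (count (ltn t) s).+1.

(* A bumping sequence a of u = c v is encoded by the bit sequence m whose i-th
   bit says whether the i-th letter of v sits at an entry of a. Reading v from
   left to right, c is the letter currently carried, dropped at a bit [true] in
   exchange for the letter there: [valid] says that the exchanged letters
   increase, [bumped] is u^a, and a is [1 :: stops 2 m]. *)
Fixpoint valid (c : nat) (v : seq nat) (m : seq bool) : bool :=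
  match v, m with
  | x :: v', e :: m' => if e then (c < x)%N && valid x v' m' else valid c v' m'
  | _, _ => true
  end.

Fixpoint bumped (c : nat) (v : seq nat) (m : seq bool) : seq nat :=
  match v, m with
  | x :: v', e :: m' => if e then c :: bumped x v' m' else x :: bumped c v' m'
  | _, _ => [:: c]
  end.

Fixpoint stops (p : nat) (m : seq bool) : seq nat :=
  if m is e :: m' then if e then p :: stops p.+1 m' else stops p.+1 m'
  else [:: p].

Lemma perm_bumped c v m : size m = size v -> perm_eq (bumped c v m) (c :: v).
Proof.
elim: v c m => [|x v IH] c [|e m] //= [sz].
case: e; first by rewrite perm_cons IH.
apply: perm_trans (_ : perm_eq (x :: c :: v) _); first by rewrite perm_cons IH.
by rewrite -[x :: c :: v]/([:: x] ++ [:: c] ++ v) perm_catCA.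
Qed.

Lemma stops_neq_nil p m : stops p m != [::].
Proof. by elim: m p => //= -[]. Qed.

Lemma mem_stops p m i : i \in stops p m -> (p <= i <= p + size m)%N.
Proof.
elim: m p => [|e m IH] p /=; first by rewrite inE => /eqP ->; lia.
by case: e; rewrite ?inE; [case/predU1P => [->|/IH]|move/IH]; lia.
Qed.

Lemma path_stops p0 p m : (p0 < p)%N -> path ltn p0 (stops p m).
Proof.
elim: m p0 p => [|e m IH] p0 p lt_p /=; first by rewrite lt_p.
by case: e => /=; rewrite ?lt_p IH //; lia.
Qed.

Lemma last_stops p0 p m : last p0 (stops p m) = (p + size m)%N.
Proof.
elim: m p0 p => [|e m IH] p0 p /=; first by rewrite addn0.
by case: e => /=; rewrite IH addSnnS.
Qed.

Lemma size_stops p m : (size (stops p m) <= (size m).+1)%N.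
Proof. by elim: m p => [|[] m IH] p //=; have := IH p.+1; lia. Qed.

Lemma stops_mem p m :
  [seq i \in stops p m | i <- iota p (size m)] = m.
Proof.
elim: m p => [|e m IH] p //=; congr cons.
  case: e; first by rewrite inE eqxx.
  by apply/negP => /mem_stops; lia.
rewrite -[RHS](IH p.+1); apply/eq_in_map => i; rewrite mem_iota => ri.
by case: e => //; rewrite inE; have /negbTE -> : i != p by lia.
Qed.

Lemma mem_stops_map (f : nat -> bool) p k i :
  (i \in stops p [seq f j | j <- iota p k])
  = (p <= i < p + k)%N && f i || (i == p + k)%N.
Proof.
elim: k p => [|k IH] p /=; first by rewrite inE; lia.
have -> : (i \in (if f p then p :: stops p.+1 [seq f j | j <- iota p.+1 k]
                  else stops p.+1 [seq f j | j <- iota p.+1 k]))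
  = (i == p) && f p || (i \in stops p.+1 [seq f j | j <- iota p.+1 k]).
  by case: (f p); rewrite ?inE ?andbT ?andbF.
rewrite IH; case: (eqVneq i p) => [->|ip]; case: (f _); lia.
Qed.

Lemma leq_last (s : seq nat) i : sorted ltn s -> i \in s -> (i <= last 0 s)%N.
Proof.
case/lastP: s => // s b; rewrite last_rcons mem_rcons inE.
move=> srt /predU1P[->//|si]; apply: ltnW.
rewrite -cats1 in srt; move: srt; rewrite sorted_pairwise; last exact: ltn_trans.
by rewrite pairwise_cat allrel1r => /and3P[/allP /(_ _ si)].
Qed.

(** Two strictly increasing sequences with the same members are equal. The last entry of [a] bounds
    all others, so the bits at [p.+1, ..., p + k] together with that last entry determine [a]. *)
Lemma stops_of_mem p k a : path ltn p a ->
  last 0%N a = (p.+1 + k)%N -> stops p.+1 [seq i \in a | i <- iota p.+1 k] = a.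
Proof.
move=> pa la; apply: (irr_sorted_eq ltn_trans ltnn).
- exact: path_sorted (path_stops _ (ltnSn p)).
- exact: path_sorted pa.
move=> i; rewrite mem_stops_map -la.
have [ia|/=] := boolP (i \in a).
  have := leq_last (path_sorted pa) ia.
  by move: pa; rewrite path_sortedE; [case/andP => /allP/(_ _ ia)|exact: ltn_trans]; lia.
rewrite andbF /= => ia; apply/negP => /eqP il; case/negP: ia; rewrite il.
by case: a la {pa il} => [|x a] //= _; apply: mem_last.
Qed.

(** * From positions in a word to its suffixes *)

Lemma JE T u p t : (p <= size u)%N -> J T u p.+1 t = rank (drop p u) t.
Proof.
move=> pu; rewrite /J /rank add1n /index_iota subSS; congr S.
rewrite -[in RHS](mkseq_nth T.+1 u) -map_drop drop_iota add0n count_map.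
by rewrite (iotaDl 1) count_map.
Qed.

Lemma drop_cons_lett T u p x v : drop p u = x :: v ->
  [/\ (p < size u)%N, lett T u p.+1 = x & drop p.+1 u = v].
Proof.
move=> uv; split; first by rewrite -subn_gt0 -size_drop uv.
  by rewrite /lett /= -[p]addn0 -nth_drop uv.
by rewrite -[RHS](drop0 v) -add1n -drop_drop uv.
Qed.

Section Bumping.
Variable T : nat.

Lemma path_lett_stops u p0 p v m :
  drop p u = v -> size m = size v -> (p <= size u)%N ->
  all (fun x => x <= T)%N (lett T u p0 :: v) ->
  path (fun i j => lett T u i < lett T u j)%N p0 (stops p.+1 m)
  = valid (lett T u p0) v m.
Proof.
elim: v m p0 p => [|x v IH] [|e m] p0 p //= uv sz pu /andP[cT].
  (* The final stop lies past the end of [u], where [lett] is [T.+1]; every carried letter is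
     smaller, so the last comparison always holds. *)
  move=> _; rewrite {2}/lett /= nth_default ?ltnS ?cT //.
  by rewrite -subn_eq0 -size_drop uv.
move=> /andP[xT vT].
have [ltpu xE uv'] := drop_cons_lett T uv.
case: sz => sz.
case: e => /=; first by rewrite xE (IH m p.+1 p.+1) ?xE //= xT.
by rewrite (IH m) //= cT.
Qed.

(** Here [p0] is the position where the carried letter was picked up. Since it heads the list and
    [entry] is 1-based, [index] of a stop points at the preceding stop, whose letter is dropped. *)
Lemma bump_stops u p0 p v m :
  drop p u = v -> size m = size v -> (p <= size u)%N -> (p0 <= p)%N ->
  [seq (if i.+1 \in stops p.+1 m
        then lett T u (entry (p0 :: stops p.+1 m) (index i.+1 (p0 :: stops p.+1 m)))
        else lett T u i.+1) | i <- iota p (size v).+1]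
  = bumped (lett T u p0) v m.
Proof.
elim: v m p0 p => [|x v IH] [|e m] p0 p // uv sz pu p0p.
  by rewrite /= inE eqxx /entry; case: eqP => //=; lia.
have [ltpu xE uv'] := drop_cons_lett T uv.
case: sz => sz.
have nmem : (p.+1 \in stops p.+2 m) = false by apply/negP => /mem_stops; lia.
rewrite -[iota _ _]/(p :: iota p.+1 (size v).+1) map_cons.
rewrite -[stops _ _]/(if e then p.+1 :: stops p.+2 m else stops p.+2 m).
rewrite -[bumped _ _ _]/(if e then lett T u p0 :: bumped x v m else x :: bumped (lett T u p0) v m).
case: e; congr cons.
- by rewrite inE eqxx /entry /= eqxx; case: eqP => //=; lia.
- rewrite -xE -(IH m p.+1 p.+1) //.
  apply/eq_in_map => i; rewrite mem_iota => ri.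
  rewrite inE /entry.
  have /negbTE -> /= : i.+1 != p.+1 by lia.
  case: ifP => // im.
  have /negbTE -> /= : p0 != i.+1 by lia.
  by have /negbTE -> : p.+1 != i.+1 by lia.
- by rewrite nmem.
- by rewrite -(IH m p0 p.+1) //; lia.
Qed.

Lemma is_bumping_stops c v m :
  size m = size v -> all (fun x => x <= T)%N (c :: v) ->
  is_bumping T (c :: v) (1%N :: stops 2 m) = valid c v m.
Proof.
move=> sz cv; rewrite /is_bumping /= path_stops //= /entry /=.
rewrite nth_last /= last_stops sz eqxx /=.
by rewrite (path_lett_stops (v := v)) //= drop0.
Qed.

Lemma bump_cons_stops c v m :
  size m = size v -> Defs.bump T (c :: v) (1%N :: stops 2 m) = bumped c v m.
Proof.
move=> sz; rewrite -[c]/(lett T (c :: v) 1) -(bump_stops (p := 1)) //= ?drop0 //.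
Qed.

Lemma is_bumpingP u a : (0 < size u)%N -> is_bumping T u a ->
  a = 1%N :: stops 2 [seq i \in a | i <- iota 2 (size u).-1].
Proof.
move=> u0 /and4P[]; case: a => [|x a] //=; rewrite /entry /= => pa /eqP xE.
subst x; rewrite (nth_last 0%N (1%N :: a)) => /eqP /= la _; congr cons.
have {}la : last 0%N a = (2 + (size u).-1)%N.
  by case: a la {pa} => [|b a] /=; lia.
rewrite -[LHS](stops_of_mem pa la); congr stops.
apply/eq_in_map => i; rewrite mem_iota inE => ri.
by have /negbTE -> : i != 1%N by lia.
Qed.

End Bumping.

(** * Ranks, and weights of words and bumpings *)

Lemma rank_le s t : (0 < rank s t <= (size s).+1)%N.
Proof. by rewrite /rank /= ltnS count_size. Qed.

Lemma rank_cons_self s x : rank (x :: s) x = rank s x.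
Proof. by rewrite /rank /= ltnn. Qed.

Lemma rank_max s t : all (fun x => x <= t)%N s -> rank s t = 1%N.
Proof.
move=> st; rewrite /rank (eq_in_count (a2 := pred0)) ?count_pred0 // => x xs.
by have /allP/(_ _ xs) := st; rewrite leqNgt => /negbTE.
Qed.

Section Weights.
Variables (R : realFieldType) (z : nat -> R).

Lemma yS i : y z i.+1 = y z i + z i.+1.
Proof. by rewrite /y big_nat_recr. Qed.

Lemma y1 : y z 1 = z 1%N.
Proof. by rewrite /y big_nat1. Qed.

(* The transition weight of a bumping, with an extra denominator for the first
   carried letter; d is the index of the denominator of the letter c carried. *)
Fixpoint ratio (d c : nat) (v : seq nat) (m : seq bool) : R :=
  match v, m with
  | x :: v', e :: m' =>
      if e then z (rank (x :: v') c) / y z d * ratio (rank v' x) x v' m'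
      else ratio d c v' m'
  | _, _ => z 1%N / y z d
  end.

(* [yprod (c :: v)] times [ratio], after cancellation of the denominators. *)
Fixpoint joint (c : nat) (v : seq nat) (m : seq bool) : R :=
  match v, m with
  | x :: v', e :: m' =>
      if e then z (rank (x :: v') c) * joint x v' m'
      else y z (rank v' x) * joint c v' m'
  | _, _ => z 1%N
  end.

Fixpoint yprod (s : seq nat) : R :=
  if s is x :: s' then y z (rank s' x) * yprod s' else 1.

(** The denominator brought in by a picked-up letter [x] equals the factor of [x] in [yprod], so a
    bit [true] cancels that factor and a bit [false] leaves it in [joint]. *)
Lemma joint_ratio N d c v m :
  (forall i, (0 < i <= N)%N -> y z i != 0) ->
  size m = size v -> (size v < N)%N -> (0 < d <= N)%N ->
  joint c v m = ratio d c v m * (y z d * yprod v).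
Proof.
move=> y_neq0; elim: v c d m => [|x v IH] c d [|e m] //= sz vN dN.
  by rewrite mulr1 divfK ?y_neq0.
case: sz => sz; have xN : (0 < rank v x <= N)%N by have := rank_le v x; lia.
case: e.
  rewrite (IH x (rank v x)) //; last by lia.
  by field; rewrite y_neq0.
by rewrite (IH c d) //; [ring | lia].
Qed.

(** No letter exceeds [c], so validity excludes every bit [true] and [c] travels to the end. *)
Lemma ratio_max d c v m : size m = size v -> all (fun x => x <= c)%N v ->
  valid c v m -> ratio d c v m = z 1%N / y z d.
Proof.
elim: v m => [|x v IH] [|e m] //= [sz] /andP[xc vc].
by case: e; [rewrite ltnNge xc | exact: IH].
Qed.

Lemma ratio_gt0 N d c v m :
  (forall i, (0 < i <= N)%N -> 0 < z i) -> (forall i, (0 < i <= N)%N -> 0 < y z i) ->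
  (size v < N)%N -> (0 < d <= N)%N -> 0 < ratio d c v m.
Proof.
move=> z_gt0 y_gt0; elim: v d c m => [|x v IH] d c [|e m] /= vN dN;
  try by rewrite divr_gt0 ?z_gt0 ?y_gt0; lia.
have rx := rank_le v x; have := rank_le (x :: v) c; rewrite [size _]/= => rc.
case: e; last by apply: IH => //; lia.
apply: mulr_gt0; first by apply: divr_gt0; [apply: z_gt0|apply: y_gt0]; lia.
by apply: IH; lia.
Qed.

Lemma prod_stops T u p0 p v m :
  drop p u = v -> size m = size v -> (p <= size u)%N ->
  \prod_(0 <= i < size (stops p.+1 m))
     (z (J T u (nth 0%N (stops p.+1 m) i) (lett T u (nth 0%N (p0 :: stops p.+1 m) i)))
      / y z (J T u (nth 0%N (p0 :: stops p.+1 m) i)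
               (lett T u (nth 0%N (p0 :: stops p.+1 m) i))))
  = ratio (J T u p0 (lett T u p0)) (lett T u p0) v m.
Proof.
elim: v m p0 p => [|x v IH] [|e m] p0 p // uv sz pu.
  rewrite /= big_nat1 /= JE //; congr (z _ / _).
  by rewrite uv.
have [ltpu xE uv'] := drop_cons_lett T uv.
case: sz => sz.
rewrite -[stops p.+1 (e :: m)]/(if e then p.+1 :: stops p.+2 m else stops p.+2 m).
case: e; last by rewrite /= IH.
rewrite [size _]/= big_nat_recl //= IH // xE !JE // uv.
by rewrite rank_cons_self.
Qed.

Lemma prod_y_lett T s :
  \prod_(1 <= i < (size s).+1 | (lett T s i < T)%N) y z (J T s i (lett T s i))
  = \prod_(0 <= i < size s | (nth T.+1 s i < T)%N)
      y z (rank (drop i s) (nth T.+1 s i)).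
Proof.
rewrite big_add1 /= [LHS]big_nat_cond [RHS]big_nat_cond; apply: eq_bigr => i.
by move=> /andP[/andP[_ si] _]; rewrite JE // ltnW.
Qed.

(** The law [h(v, c)]: the types below [c] fail, then [c] succeeds, and type [T] always succeeds. *)
Definition head_weight T (v : seq nat) (c : nat) : R :=
  (if (c < T)%N then y z (rank v c) else 1) * \prod_(1 <= t < c) (1 - y z (rank v t)).

Fixpoint ypart T (s : seq nat) : R :=
  if s is x :: s' then (if (x < T)%N then y z (rank s' x) else 1) * ypart T s'
  else 1.

Definition cpart T (s : seq nat) : R :=
  \prod_(2 <= l < T.+1) \prod_(1 <= p < (count (leq l) s).+1) (1 - y z p).

Definition seq_weight T s : R := ypart T s * cpart T s.

Lemma ypartE T s :
  \prod_(1 <= i < (size s).+1 | (lett T s i < T)%N) y z (J T s i (lett T s i))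
  = ypart T s.
Proof.
rewrite prod_y_lett; elim: s => [|x s IH] /=; first by rewrite big_geq.
rewrite -IH !(big_mkcond (fun i => nth _ _ i < T)%N) /=.
by rewrite big_nat_recl //= rank_cons_self.
Qed.

(** No letter exceeds [T], so each occurrence of [T] has rank 1 and contributes [y z 1] to [yprod]
    and 1 to [ypart]. *)
Lemma ypart_yprod T s : all (fun x => x <= T)%N s ->
  ypart T s * y z 1 ^+ count (leq T) s = yprod s.
Proof.
elim: s => [|x s IH] /=; first by rewrite mulr1.
move=> /andP[xT sT]; rewrite -{}IH //; case: ltnP => xT'; first by rewrite add0n mulrA.
have -> : x = T by lia.
by rewrite (rank_max sT) mul1r exprS; ring.
Qed.

Lemma cpart_perm T s s' : perm_eq s s' -> cpart T s = cpart T s'.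
Proof.
by move=> /seq.permP ss'; apply: eq_bigr => l _; rewrite ss'.
Qed.

(** Prepending [c] raises the number of letters at least [l] by one exactly when [l <= c]. The new
    factor of [cpart] is [1 - y z (rank v l.-1)]; for [l >= 2] these are the failure factors of the
    types [t = l.-1] below [c]. *)
Lemma seq_weight_cons T c v : (0 < c <= T)%N ->
  seq_weight T (c :: v) = head_weight T v c * seq_weight T v.
Proof.
move=> cT; rewrite /seq_weight /head_weight /=.
suff -> : cpart T (c :: v) = \prod_(1 <= t < c) (1 - y z (rank v t)) * cpart T v.
  by ring.
have -> : \prod_(1 <= t < c) (1 - y z (rank v t))
  = \prod_(2 <= l < T.+1) (if (l <= c)%N then 1 - y z (rank v l.-1) else 1).
  transitivity (\prod_(2 <= l < c.+1) (1 - y z (rank v l.-1))).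
    by rewrite [RHS]big_add1.
  by rewrite -big_mkcond (@big_nat_widen _ _ _ 2 c.+1 T.+1) //; lia.
rewrite -big_split /=; apply: eq_big_nat => l /andP[l2 _] /=.
have <- : (count (leq l) v).+1 = rank v l.-1.
  by rewrite /rank; case: l l2 => //.
case: (leq l c); last by rewrite mul1r.
by rewrite add1n big_nat_recr //= mulrC.
Qed.

Lemma sum_head_weight T v : (0 < T)%N ->
  \sum_(c < T) head_weight T v c.+1 = 1.
Proof.
case: T => // T _; rewrite big_ord_recr /= {2}/head_weight ltnn mul1r.
rewrite (eq_bigr (fun c : 'I_T => y z (rank v c.+1)
    * \prod_(1 <= t < c.+1) (1 - y z (rank v t)))); last first.
  by move=> c _; rewrite /head_weight ltnS ltn_ord.
(* Telescoping: the probability that all types so far fail splits into success and failure of the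
   next type. *)
elim: T => [|T IH]; first by rewrite big_ord0 add0r big_geq.
by rewrite big_ord_recr /= [in X in _ + X]big_nat_recr //= -[RHS]IH; ring.
Qed.

End Weights.

(** * Summation over words and bumpings *)

Lemma big_tcons (V : nmodType) (I : finType) k (F : k.+1.-tuple I -> V) :
  \sum_(w : k.+1.-tuple I) F w
  = \sum_(c : I) \sum_(v : k.-tuple I) F [tuple of c :: v].
Proof.
rewrite pair_bigA /= (reindex (fun p : I * k.-tuple I => [tuple of p.1 :: p.2])) //=.
exists (fun w => (thead w, [tuple of behead w])) => [[c v] _|w _] /=.
  by congr pair; apply: val_inj.
by rewrite [RHS]tuple_eta.
Qed.

Lemma sum_if_eq (V : nmodType) (I : finType) (b : I) (F : I -> V) :
  \sum_(c : I) (if c == b then F c else 0) = F b.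
Proof. by rewrite -big_mkcond big_pred1_eq. Qed.

Lemma size_letters n T (w : word n T) : size (letters w) = n.
Proof. by rewrite size_map size_tuple. Qed.

Lemma letters_le n T (w : word n T) : all (fun x => x <= T)%N (letters w).
Proof. by apply/allP => _ /mapP[c _ ->]; apply: ltn_ord. Qed.

Section Stationary.
Variables (R : realFieldType) (z : nat -> R).

(* If w = b w' and (x, v, m) is a bumping producing w', then b is either the
   letter carried before x was picked up, which requires b < x, or a letter that
   was passed over. With r = rank w' b, the two cases contribute z_r and y_{r-1}
   when b < x, and 0 and y_r otherwise, so y_r in total. *)
Lemma sum_joint T k (w : k.+1.-tuple 'I_T) :
  \sum_(c : 'I_T) \sum_(v : k.-tuple 'I_T)
    \sum_(m : k.-tuple bool | valid c.+1 (letters v) m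
                              && (bumped c.+1 (letters v) m == letters w))
      joint z c.+1 (letters v) m
  = yprod z (letters w).
Proof.
elim: k w => [|k IH] w.
  case/tupleP: w => b w; rewrite (tuple0 w) /= mulr1 /rank /= y1.
  rewrite -[RHS](sum_if_eq b (fun=> z 1%N)); apply: eq_bigr => c _.
  rewrite (big_pred1 [tuple]); last by move=> v; rewrite (tuple0 v) /= eqxx.
  rewrite big_mkcond (big_pred1 [tuple]) /=; last by move=> m; rewrite (tuple0 m) /= eqxx.
  by rewrite !eqseq_cons /= andbT eqSS.
case/tupleP: w => b w; set s := letters w.
have -> : letters [tuple of b :: w] = b.+1 :: s by [].
rewrite [RHS]/= -{}IH -/s.
pose G (x : 'I_T) (v : k.-tuple 'I_T) (m : k.-tuple bool) : R :=
  if valid x.+1 (letters v) m && (bumped x.+1 (letters v) m == s)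
  then joint z x.+1 (letters v) m else 0.
pose alpha (x : 'I_T) := if (b < x)%N then z (rank s b.+1) else 0.
pose beta (x : 'I_T) := y z (rank s b.+1 - (b < x)).
have alpha_beta x : alpha x + beta x = y z (rank s b.+1).
  rewrite /alpha /beta; case: (_ < _)%N; rewrite /rank ?subn1 ?subn0 ?add0r //=.
  by rewrite yS addrC.
(* When [G] is nonzero, [s] is a rearrangement of [x.+1 :: letters v], so the two ranks differ by
   the contribution of [x] alone. *)
have betaE x v m : G x v m != 0 -> beta x = y z (rank (letters v) b.+1).
  rewrite /G; case: ifP; last by rewrite eqxx.
  move=> /andP[_ /eqP sE] _; rewrite /beta /rank -sE.
  have /perm_bumped/seq.permP -> : size m = size (letters v).
    by rewrite size_letters size_tuple.
  by rewrite /= ltnS -addnS addKn.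
(* Case split on the first bit: [true] drops [c] in front, forcing [c = b], and carries [x] on;
   [false] passes over [x], forcing [x = b], and carries [c] on. *)
have step (c x : 'I_T) (v : k.-tuple 'I_T) :
  \sum_(m : k.+1.-tuple bool | valid c.+1 (letters [tuple of x :: v]) m
          && (bumped c.+1 (letters [tuple of x :: v]) m == b.+1 :: s))
      joint z c.+1 (letters [tuple of x :: v]) m
  = (if c == b then \sum_m alpha x * G x v m else 0)
    + (if x == b then \sum_m beta c * G c v m else 0).
  rewrite big_mkcond big_tcons /= big_bool /=; congr (_ + _).
    case: eqP => [->|/eqP ncb]; last first.
      have {}ncb : (c == b :> nat) = false by apply/negbTE.
      by rewrite big1 // => m _; rewrite eqseq_cons eqSS ncb /= andbF.
    apply: eq_bigr => m _; rewrite eqseq_cons eqxx /= ltnS /alpha /G.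
    case: ifP => [/andP[/andP[-> ->]] /= /eqP sE|].
      rewrite sE eqxx /rank; congr (z _.+1 * _).
      have /perm_bumped/seq.permP pe : size m = size (letters v).
        by rewrite size_letters size_tuple.
      by rewrite -sE pe.
    by case: (_ < _)%N => /=; [move=> -> ; rewrite mulr0 | rewrite mul0r].
  case: eqP => [->|/eqP nxb]; last first.
    have {}nxb : (x == b :> nat) = false by apply/negbTE.
    by rewrite big1 // => m _; rewrite eqseq_cons eqSS nxb /= andbF.
  apply: eq_bigr => m _; rewrite eqseq_cons eqxx /=.
  have [G0|/betaE ->] := eqVneq (G c v m) 0; last first.
    by rewrite /G; case: ifP => _; rewrite ?mulr0.
  by rewrite G0 mulr0; move: G0; rewrite /G; case: ifP => // _ ->; rewrite mulr0.
have -> : \sum_(c < T) \sum_(v : k.+1.-tuple 'I_T)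
    \sum_(m : k.+1.-tuple bool | valid c.+1 (letters v) m
                              && (bumped c.+1 (letters v) m == b.+1 :: s))
      joint z c.+1 (letters v) m
  = \sum_(c < T) \sum_(x < T) \sum_(v : k.-tuple 'I_T)
     ((if c == b then \sum_m alpha x * G x v m else 0)
    + (if x == b then \sum_m beta c * G c v m else 0)).
  apply: eq_bigr => c _; rewrite big_tcons; apply: eq_bigr => x _.
  by apply: eq_bigr => v _; rewrite step.
under eq_bigr do under eq_bigr do rewrite big_split /=.
under eq_bigr do rewrite big_split /=.
(* After the exchange, the outer index of both parts is the letter carried into the tail: [x] in the
   first, [c] in the second. *)
rewrite big_split /= exchange_big /=.
rewrite -big_split /= mulr_sumr; apply: eq_bigr => x _.
rewrite exchange_big /= [X in _ + X]exchange_big /= -big_split /= mulr_sumr.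
apply: eq_bigr => v _; rewrite !sum_if_eq -big_split /= [X in _ * X]big_mkcond mulr_sumr /=.
by apply: eq_bigr => m _; rewrite -mulrDl alpha_beta.
Qed.

Lemma stat_weightE n T (w : word n T) : stat_weight z w = seq_weight z T (letters w).
Proof.
rewrite /stat_weight /seq_weight -ypartE size_letters; congr (_ * _).
Qed.

Lemma sum_stat_weight_cons T k (v : k.-tuple 'I_T) : (0 < T)%N ->
  \sum_(c < T) stat_weight z ([tuple of c :: v] : word k.+1 T) = stat_weight z (v : word k T).
Proof.
move=> T0; rewrite -[RHS]mul1r -(sum_head_weight z (letters v) T0) mulr_suml.
apply: eq_bigr => c _; rewrite !stat_weightE -seq_weight_cons //.
by rewrite /= ltn_ord.
Qed.

Lemma sum_stat_weight n T : (0 < T)%N -> \sum_(w : word n T) stat_weight z w = 1.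
Proof.
move=> T0; elim: n => [|n IH].
  rewrite (big_pred1 [tuple]); last by move=> w; rewrite (tuple0 w) /= eqxx.
  rewrite /stat_weight big_geq // mul1r big1 // => l _.
  by rewrite big_geq.
rewrite big_tcons exchange_big -[RHS]IH; apply: eq_bigr => v _.
exact: sum_stat_weight_cons.
Qed.

(** For [j < T], multiplying and dividing by [y z (rank v j)] completes the success probability of
    [j] and gives the first factor of [ratio] its denominator. For [j = T] the ratio is
    [z 1 / y z 1 = 1]. *)
Lemma q_stops n T (w : word n T) j m :
  let v := behead (letters w) in
  (forall i, (0 < i <= n)%N -> y z i != 0) -> (0 < n)%N ->
  size m = size v -> (0 < j <= T)%N -> valid j v m ->
  q z w j (1%N :: stops 2 m) = head_weight z T v j * ratio z (rank v j) j v m.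
Proof.
move=> v y_neq0 n0 sz jT jvm; rewrite /q /replace_first -/v /head_weight.
have vn : size v = n.-1 by rewrite size_behead size_letters.
have vT : all (fun x => x <= T)%N v.
  by apply/allP => x /mem_behead; move: x; apply/allP; apply: letters_le.
have J2 t : J T (j :: v) 2 t = rank v t by rewrite JE //= drop0.
case: ltnP => jT'; last first.
  have jE : j = T by lia.
  rewrite jE in jvm J2 *; rewrite ratio_max // rank_max // y1 divff ?mulr1 ?mul1r //.
    by apply: eq_bigr => t _; rewrite J2.
  by rewrite -y1 y_neq0.
under eq_bigr do rewrite J2.
have := @prod_stops _ z T (j :: v) 1 1 v m (drop0 _) sz isT.
rewrite JE // drop0 [lett _ _ _]/= rank_cons_self => <-.
have := stops_neq_nil 2 m; case: (stops 2 m) => // s0 s _.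
set B := \prod_(1 <= t < j) _.
rewrite [in RHS]/= [in RHS]big_nat_recl // 3![in LHS]big_add1 /= JE // drop0 rank_cons_self.
have : y z (rank v j) != 0 by rewrite y_neq0 //; have := rank_le v j; lia.
rewrite /entry /=; set A := \prod_(0 <= i < _) _.
by move=> yj; field.
Qed.

End Stationary.

(** * Transition probabilities and the balance equation *)

Section Transition.
Variables (R : realFieldType) (z : nat -> R) (k T : nat).
Implicit Types w : word k.+1 T.

Definition stops_bseq (m : k.-tuple bool) : {bseq k.+2 of 'I_k.+3} :=
  insub_bseq k.+2 (map inord (1%N :: stops 2 m)).

(** Entries and length are at most [k.+2], so neither [inord] nor [insub_bseq] falls back on its
    default value. *)
Lemma val_stops_bseq m : map val (stops_bseq m) = 1%N :: stops 2 m.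
Proof.
rewrite /stops_bseq /insub_bseq insubdK /=; last first.
  by rewrite unfold_in /= size_map ltnS -{2}(size_tuple m) size_stops.
rewrite inordK //; congr cons; rewrite -map_comp map_id_in // => i /mem_stops.
by rewrite size_tuple /= => im; rewrite inordK //; lia.
Qed.

Definition mask_of (a : {bseq k.+2 of 'I_k.+3}) : k.-tuple bool :=
  [tuple of [seq i \in map val a | i <- iota_tuple k 2]].

Lemma stops_bseqK : cancel stops_bseq mask_of.
Proof.
move=> m; apply: val_inj; rewrite /= val_stops_bseq.
rewrite -[RHS](stops_mem 2) size_tuple; apply/eq_in_map => i.
by rewrite mem_iota inE; case: eqP => [->|].
Qed.

Lemma mask_ofK u (a : {bseq k.+2 of 'I_k.+3}) : size u = k.+1 -> is_bumping T u (map val a) ->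
  stops_bseq (mask_of a) = a.
Proof.
move=> su au; apply: val_inj; apply: (inj_map val_inj).
rewrite val_stops_bseq [RHS](is_bumpingP _ au) ?su //=.
Qed.

(** Reindexes bumping sequences by their bit sequences. The result sees [w] only through its tail,
    so the chain forgets the first letter. *)
Lemma transitionE w w' :
  let v := behead (letters w) in
  (forall i, (0 < i <= k.+1)%N -> y z i != 0) ->
  transition z w w' =
  \sum_(j < T) \sum_(m : k.-tuple bool | valid j.+1 v m
                                        && (bumped j.+1 v m == letters w'))
     head_weight z T v j.+1 * ratio z (rank v j.+1) j.+1 v m.
Proof.
move=> v y_neq0; rewrite /transition big_add1 /= big_mkord; apply: eq_bigr => j _.
have vk : size v = k by rewrite size_behead size_letters.
have su : size (replace_first j.+1 w) = k.+1 by rewrite /= vk.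
have uT : all (fun x => x <= T)%N (j.+1 :: v).
  rewrite /= ltn_ord; apply/allP => x /mem_behead; move: x; apply/allP.
  exact: letters_le.
rewrite (reindex_onto stops_bseq mask_of); last first.
  by move=> a /andP[/mask_ofK -> //].
have szm (m : k.-tuple bool) : size m = size v by rewrite size_tuple vk.
apply: eq_big => [m|m].
  rewrite stops_bseqK eqxx andbT val_stops_bseq is_bumping_stops //.
  by rewrite bump_cons_stops.
rewrite val_stops_bseq is_bumping_stops // => /andP[/andP[vm _] _].
by rewrite q_stops // ltn_ord.
Qed.

Hypothesis z_gt0 : forall i, (0 < i <= k.+1)%N -> 0 < z i.
Hypothesis y_lt1 : forall i, (0 < i <= k.+1)%N -> y z i < 1.
Hypothesis T_gt0 : (0 < T)%N.

Lemma y_gt0 i : (0 < i <= k.+1)%N -> 0 < y z i.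
Proof.
elim: i => // -[_ _|i IH ik]; first by rewrite y1 z_gt0.
by rewrite yS addr_gt0 ?z_gt0 ?IH //; lia.
Qed.

Lemma y_neq0 i : (0 < i <= k.+1)%N -> y z i != 0.
Proof. by move/y_gt0; rewrite lt0r => /andP[]. Qed.

Lemma head_weight_gt0 v c : (size v <= k)%N -> 0 < head_weight z T v c.
Proof.
move=> vk; have vN t : (0 < rank v t <= k.+1)%N by have := rank_le v t; lia.
rewrite /head_weight mulr_gt0 //; first by case: ifP => // _; rewrite y_gt0.
by apply: prodr_gt0 => t _; rewrite subr_gt0 y_lt1.
Qed.

Lemma seq_weight_gt0 s : (size s <= k.+1)%N -> all (fun c => 0 < c <= T)%N s ->
  0 < seq_weight z T s.
Proof.
elim: s => [|c s IH] /=.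
  move=> _ _; rewrite /seq_weight /cpart mul1r big1 // => l _.
  by rewrite big_geq.
move=> sk /andP[cT sT]; rewrite seq_weight_cons //.
by rewrite mulr_gt0 ?head_weight_gt0 ?IH // ltnW.
Qed.

Lemma stat_weight_gt0 w : 0 < stat_weight z w.
Proof.
rewrite stat_weightE seq_weight_gt0 ?size_letters //.
by apply/allP => _ /mapP[c _ ->]; rewrite /= ltn_ord.
Qed.

Lemma summand_gt0 w c m :
  0 < head_weight z T (behead (letters w)) c
      * ratio z (rank (behead (letters w)) c) c (behead (letters w)) m.
Proof.
set v := behead _; have vk : size v = k by rewrite size_behead size_letters.
rewrite mulr_gt0 ?head_weight_gt0 ?vk //.
apply: (ratio_gt0 _ _ z_gt0 y_gt0); first by rewrite vk.
by have := rank_le v c; rewrite vk.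
Qed.

Lemma transition_ge0 w w' : 0 <= transition z w w'.
Proof.
rewrite (transitionE _ _ y_neq0); apply: sumr_ge0 => j _; apply: sumr_ge0 => m _.
exact/ltW/summand_gt0.
Qed.

Lemma bumped_nseq c v : bumped c v (nseq (size v) false) = rcons v c.
Proof. by elim: v => //= x v ->. Qed.

Lemma valid_nseq c v : valid c v (nseq (size v) false).
Proof. by elim: v. Qed.

Lemma transition_rcons_gt0 w w' (j : 'I_T) :
  letters w' = rcons (behead (letters w)) j.+1 -> 0 < transition z w w'.
Proof.
move=> w'E; rewrite (transitionE _ _ y_neq0) (bigD1 j) //=.
have vk : size (behead (letters w)) = k by rewrite size_behead size_letters.
(* The all-[false] bits encode the bumping sequence [(1, n+1)], which puts [j] at the end. *)
rewrite (bigD1 [tuple of nseq k false]) /=; last first.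
  have -> : nseq k false = nseq (size (behead (letters w))) false by rewrite vk.
  by rewrite valid_nseq bumped_nseq w'E eqxx.
rewrite -addrA ltr_pwDl ?summand_gt0 // addr_ge0 ?sumr_ge0 // => i _.
  exact/ltW/summand_gt0.
by apply: sumr_ge0 => m _; apply/ltW/summand_gt0.
Qed.

Lemma stat_weight_stationary w' :
  \sum_w stat_weight z w * transition z w w' = stat_weight z w'.
Proof.
rewrite stat_weightE /seq_weight.
have y1N := y_neq0 (isT : (0 < 1 <= k.+1)%N).
(* Giving each letter [T] a factor [y z 1] treats all letters alike, which is the form [sum_joint]
   provides. *)
have -> : ypart z T (letters w')
  = yprod z (letters w') / y z 1 ^+ count (leq T) (letters w').
  by rewrite -(ypart_yprod z (letters_le w')) mulfK // expf_neq0.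
rewrite -sum_joint [in RHS]exchange_big /= 2!mulr_suml.
rewrite big_tcons exchange_big /=.
(* The weights of the words [c v] sum to the weight of [v]. The transition ignores the first letter,
   so [Ordinal T_gt0] is an arbitrary stand-in. *)
transitivity (\sum_(v : k.-tuple 'I_T) stat_weight z (v : word k T) *
   transition z ([tuple of Ordinal T_gt0 :: v] : word k.+1 T) w').
  apply: eq_bigr => v _; rewrite -sum_stat_weight_cons // mulr_suml.
  by apply: eq_bigr => c _; congr (_ * _); rewrite !(transitionE _ _ y_neq0).
apply: eq_bigr => v _; rewrite (transitionE _ _ y_neq0) /= mulr_sumr.
rewrite 2!mulr_suml; apply: eq_bigr => c _; rewrite mulr_sumr 2!mulr_suml.
apply: eq_bigr => m /andP[vm /eqP bm].
rewrite stat_weightE -[map _ _]/(letters (v : word k T)) in bm vm *.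
set s := letters (v : word k T) in vm bm *.
have sk : size s = k by rewrite size_letters.
have sm : size m = size s by rewrite size_tuple sk.
have pm : perm_eq (letters w') (c.+1 :: s) by rewrite -bm perm_bumped.
have cT : (0 < c.+1 <= T)%N by rewrite /= ltn_ord.
(* The head weight turns the weight of [s] into that of [c.+1 :: s]. This word has the letters of
   [w'], so [cpart] and the power of [y z 1] agree on both sides. *)
rewrite mulrA [_ * head_weight _ _ _ _]mulrC -/s -seq_weight_cons //.
rewrite /seq_weight (cpart_perm z T pm) (seq.permP pm).
have rk := rank_le s c.+1; rewrite sk in rk.
rewrite (@joint_ratio _ z k.+1 (rank s c.+1) c.+1 s m y_neq0 sm) ?sk //.
have -> : y z (rank s c.+1) * yprod z s = yprod z (c.+1 :: s) by [].
rewrite -(@ypart_yprod _ z T); last by rewrite /= ltn_ord; apply: letters_le.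
have : y z 1 ^+ count (leq T) (c.+1 :: s) != 0 by rewrite expf_neq0.
by set Y := _ ^+ _ => YN; field.
Qed.

(** * Uniqueness of the stationary distribution *)

Lemma stationary_unique (mu nu : word k.+1 T -> R) :
  (forall w, 0 < nu w) -> is_stationary_distribution (transition z) nu ->
  is_stationary_distribution (transition z) mu -> forall w, mu w = nu w.
Proof.
move=> nu_gt0 [_ nu1 nuP] [_ mu1 muP].
(* Minimum principle: with [r] the least ratio [mu / nu], the function [d = mu - r * nu] is
   nonnegative, invariant and zero at [w0]. A zero of [d] spreads to every state with a positive
   transition into it. *)
pose w0 := [arg min_(w < [tuple of nseq k.+1 (Ordinal T_gt0)]) (mu w / nu w)]%O.
have w0_min w : mu w0 / nu w0 <= mu w / nu w.
  by rewrite /w0; case: arg_minP => // i _; apply.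
set r := mu w0 / nu w0 in w0_min.
pose d w := mu w - r * nu w.
have d_ge0 w : 0 <= d w by rewrite subr_ge0 -ler_pdivlMr.
have dw0 : d w0 = 0 by rewrite /d /r divfK ?subrr // gt_eqF.
have dP w' : \sum_w d w * transition z w w' = d w'.
  rewrite /d -muP -nuP mulr_sumr -sumrB; apply: eq_bigr => w _; ring.
have d_pred w w' (j : 'I_T) :
    letters w' = rcons (behead (letters w)) j.+1 -> d w' = 0 -> d w = 0.
  move=> w'E; rewrite -dP => /psumr_eq0P /(_ w isT) => dz.
  have /eqP := dz (fun i _ => mulr_ge0 (d_ge0 i) (transition_ge0 i w')).
  by rewrite mulf_eq0 (gt_eqF (transition_rcons_gt0 w'E)) orbF => /eqP.
have d0 w : d w = 0.
  (* A window of length [k.+1] sliding along [w ++ w0] is a path of appending moves from [w] to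
     [w0]; the zero of [d] is carried back along it. *)
  pose s := (val w ++ val w0); pose x0 := Ordinal T_gt0.
  pose f i : word k.+1 T := [tuple nth x0 s (i + l) | l < k.+1].
  have fE i : letters (f i) = [seq (val (nth x0 s j)).+1 | j <- iota i k.+1].
    apply: (@eq_from_nth _ 0%N) => [|l]; rewrite size_letters ?size_map ?size_iota //.
    move=> lk; rewrite (nth_map x0) ?size_tuple // (nth_map 0%N) ?size_iota //.
    by rewrite nth_iota // -(tnth_nth x0 _ (Ordinal lk)) tnth_mktuple.
  have f_last : f k.+1 = w0.
    apply: eq_from_tnth => l; rewrite tnth_mktuple nth_cat size_tuple.
    by rewrite ltnNge leq_addr /= addKn (tnth_nth x0).
  have f_0 : f 0%N = w.
    apply: eq_from_tnth => l; rewrite tnth_mktuple nth_cat size_tuple.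
    by rewrite add0n ltn_ord (tnth_nth x0).
  have fz i : (i <= k.+1)%N -> d (f (k.+1 - i)%N) = 0.
    elim: i => [|i IH] ik; first by rewrite subn0 f_last.
    apply: (d_pred _ (f (k.+1 - i)%N) (nth x0 s (k.+1 - i + k)%N)); last exact/IH/ltnW.
    have iotaSr p : iota p k.+1 = rcons (iota p k) (p + k)%N.
      by rewrite -cats1 -(iotaD p k 1) addn1.
    by rewrite subSS subSn // !fE [in LHS]iotaSr map_rcons.
  by rewrite -f_0 -(subnn k.+1) fz.
have muE w : mu w = r * nu w by have /eqP := d0 w; rewrite subr_eq0 => /eqP.
have r1 : r = 1.
  by rewrite -[LHS]mulr1 -{1}nu1 mulr_sumr -mu1; apply: eq_bigr => w _; rewrite muE.
by move=> w; rewrite muE r1 mul1r.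
Qed.

End Transition.

Theorem theorem3p5 (R : realFieldType) (n T : nat) (z : nat -> R)
    (n_ge1 : (1 <= n)%N) (T_ge1 : (1 <= T)%N)
    (z_gt0 : forall i : nat, (1 <= i <= n.+1)%N -> 0 < z i)
    (z_sum : \sum_(1 <= i < n.+2) z i = 1) :
  [/\ is_stationary_distribution (@transition R n T z) (@stat_weight R n T z),
      forall mu : word n T -> R,
        is_stationary_distribution (@transition R n T z) mu ->
        forall w : word n T, mu w = @stat_weight R n T z w,
      \sum_(w : word n T) @stat_weight R n T z w
        = (\sum_(1 <= i < n.+2) z i) ^+ (n * (T - 1))
    & (\sum_(1 <= i < n.+2) z i) ^+ (n * (T - 1)) = 1].
Proof.
case: n n_ge1 z_gt0 z_sum => // k _ z_gt0 z_sum.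
have z_pos i : (0 < i <= k.+1)%N -> 0 < z i by move=> ik; apply: z_gt0; lia.
(* As [i <= k.+1], the total sum 1 exceeds [y z i] by at least [z i.+1 > 0]. *)
have y_lt1 i : (0 < i <= k.+1)%N -> y z i < 1.
  move=> ik; rewrite -z_sum (@big_cat_nat _ _ _ i.+1) //=; last by lia.
  rewrite ltrDl big_ltn; last by lia.
  rewrite ltr_pwDl ?z_gt0 //; first by lia.
  by rewrite big_nat_cond sumr_ge0 // => l /andP[lr _]; apply/ltW/z_gt0; lia.
have stat : is_stationary_distribution (@transition R k.+1 T z) (@stat_weight R k.+1 T z).
  split; first by move=> w; apply/ltW/stat_weight_gt0.
    exact: sum_stat_weight.
  exact: stat_weight_stationary.
split=> //; last by rewrite z_sum expr1n.
- move=> mu mu_stat; have pos w : 0 < stat_weight z (w : word k.+1 T) by apply: stat_weight_gt0.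
  exact: (stationary_unique z_pos y_lt1 T_ge1 pos stat mu_stat).
- by rewrite z_sum expr1n sum_stat_weight.
Qed.
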